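(* Let $X\subset\mathbb{R}^p$ be compact, $\mathcal{U}=L^2(X)$ with inner product $\langle\cdot,\cdot\rangle$, and let $\varphi^t$ be the continuous flow generated by $\dot u=W(u)=\sum_i c_iW_i(u)$ (a finite sum), where $c_i\in\mathbb{R}$ and $W_i:\mathcal{D}(W_i)\to\mathcal{U}$ are (possibly nonlinear) operators. Let $\overline{\mathcal{U}}\subset\mathcal{D}(W)$ be invariant under $\varphi^t$ and let $w\in L^2(X)$. Let $V_i:\mathcal{D}(V_i)\to\mathcal{U}$, $i=1,\dots,n$, be (possibly nonlinear) operators with $V_1=I$ (the identity), and let $\mathcal{E}_n\subset\mathcal{D}(L)$ be the subspace spanned by the basis functionals $\zeta_i(\cdot)=\langle V_i(\cdot),w\rangle\in C(\overline{\mathcal{U}})$, $i=1,\dots,n$, so that $\zeta_1(\cdot)=\langle\cdot,w\rangle$. Here $L$ is the Lie generator of the Koopman semigroup associated with $\varphi^t$. Assume that the pairs $(u_k,\varphi^{t_s}(u_k))\in\overline{\mathcal{U}}^2$, $k=1,\dots,m$, are such that the $n\le m$ vectors $(\zeta_i(u_1),\dots,\zeta_i(u_m))$, $i=1,\dots,n$, are linearly independent. Let $$\widetilde{\mathbf{L}}^{(t_s)}=\frac{1}{t_s}\log\left(\mathbf{\Theta}_1^\dagger\mathbf{\Theta}_2\right),$$ where $\mathbf{\Theta}_1,\mathbf{\Theta}_2$ are the $m\times n$ matrices with entries $(\mathbf{\Theta}_1)_{ki}=\zeta_i(u_k)$ and $(\mathbf{\Theta}_2)_{ki}=\zeta_i(\varphi^{t_s}(u_k))$.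 Then the estimated nonlinear operator $\hat W^{(t_s)}=\sum_{i=1}^n\widetilde{\mathbf{L}}^{(t_s)}_{i1}V_i$ satisfies $$\lim_{t_s\to0}\hat W^{(t_s)}=\underset{\tilde W\in\mathrm{span}(V_1,\dots,V_n)}{\mathrm{argmin}}\ \sum_{k=1}^m\left|\left\langle\tilde W(u_k)-W(u_k),w\right\rangle\right|^2 .$$
   Context: Functions in $L^2(X)$ are real-valued and $\mathrm{span}(V_1,\dots,V_n)$ is the real linear span. The limit is taken in this finite-dimensional space, i.e. as convergence of the coefficients with respect to $V_1,\dots,V_n$. The operator $W:\mathcal{D}(W)\to\mathcal{U}$ generates a (possibly nonlinear) semiflow $(\varphi^t)_{t\ge0}$ of maps $\varphi^t:\mathcal{U}\to\mathcal{U}$: for every initial condition $u_0\in\mathcal{D}(W)$, $u(t)=\varphi^t(u_0)$ is a classical solution of $\dot u=W(u)$, $u(0)=u_0$. Standing assumptions: each map $\varphi^t:\mathcal{U}\to\mathcal{U}$, $t\ge0$, is continuous, and for each $u$ the map $t\mapsto\varphi^t(u)$ is continuous from $\mathbb{R}^+$ into $\mathcal{U}$. $\mathcal{E}=C(\overline{\mathcal{U}})$ denotes the space of bounded continuous complex-valued functionals on $\overline{\mathcal{U}}$ with the supremum norm. In particular, the assumption $\zeta_i\in C(\overline{\mathcal{U}})$ includes that $V_i$ is defined on $\overline{\mathcal{U}}$. The Koopman semigroup is $K^t\zeta=\zeta\circ\varphi^t$ for $\zeta\in\mathcal{E}$, $t\ge0$. Its Lie generator is the linear operator $L:\mathcal{D}(L)\to\mathcal{E}$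 defined pointwise by $$L\zeta(u)=\lim_{t\downarrow0}\frac{K^t\zeta(u)-\zeta(u)}{t}\quad\text{for all }u\in\overline{\mathcal{U}},\ \zeta\in\mathcal{D}(L),$$ where $\mathcal{D}(L)$ consists of those $\zeta\in\mathcal{E}$ for which this limit exists for every $u\in\overline{\mathcal{U}}$ and defines an element of $\mathcal{E}$. $\mathbf{\Theta}^\dagger$ is the Moore-Penrose pseudoinverse and $\log$ is the principal matrix logarithm. The points $u_1,\dots,u_m$ are fixed, and the sampling time $t_s>0$ tends to $0$; $\widetilde{\mathbf{L}}^{(t_s)}$ is considered for $t_s$ small enough that the logarithm is defined. $\widetilde{\mathbf{L}}^{(t_s)}_{i1}$ is the $(i,1)$ entry. *)

(* Defs.v *)
From HB Require Import structures.
From mathcomp Require Import all_boot all_order all_algebra.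
From mathcomp Require Import generic_quotient ring_quotient.
From mathcomp Require Import all_classical all_reals all_analysis.
From mathcomp Require Import measurable_realfun.
From mathcomp Require Import complex.

Set Implicit Arguments.
Unset Strict Implicit.
Unset Printing Implicit Defensive.

Import Order.TTheory GRing.Theory Num.Theory.
Import numFieldNormedType.Exports.

Local Open Scope classical_set_scope.
Local Open Scope ring_scope.

(* The library has Lebesgue measure on R only.  On R^p we take the iterated
   product measure on tuples, transported to row vectors equipped with their
   Borel sigma-algebra; [lebesgue_rV_box] identifies it as Lebesgue measure. *)

Section power_measure.
Context d (T : measurableType d) (R : realType).
Variable lam : {sigma_finite_measure set T -> \bar R}.

Let nil_sigma_finite :
  sigma_finite [set: 0.-tuple T] (\d_([tuple] : 0.-tuple T) : set _ -> \bar R).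
Proof.
exists (fun=> setT); first by rewrite bigcup_const.
by move=> _; split; [exact: measurableT | rewrite diracT ltry].
Qed.

HB.instance Definition _ := @Measure_isSigmaFinite.Build _ (0.-tuple T) R
  (\d_([tuple] : 0.-tuple T)) nil_sigma_finite.

Definition tuple_cons n (x : T * n.-tuple T) : n.+1.-tuple T :=
  [tuple of x.1 :: x.2].

Lemma measurable_tuple_cons n :
  measurable_fun [set: T * n.-tuple T] (@tuple_cons n).
Proof.
by apply: measurable_cons; [exact: measurable_fst | exact: measurable_snd].
Qed.

HB.instance Definition _ n := @isMeasurableFun.Build _ _ _ _
  (@tuple_cons n) (@measurable_tuple_cons n).

Section cons_measure.
Variables (n : nat) (mu : {sigma_finite_measure set (n.-tuple T) -> \bar R}).

Definition cons_measure : set (n.+1.-tuple T) -> \bar R :=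
  pushforward (lam \x mu)%E (@tuple_cons n).

Let cons_measure0 : cons_measure set0 = 0%E.
Proof. exact: measure0. Qed.

Let cons_measure_ge0 A : (0 <= cons_measure A)%E.
Proof. exact: measure_ge0. Qed.

Let cons_measure_sigma_additive : semi_sigma_additive cons_measure.
Proof. exact: measure_semi_sigma_additive. Qed.

HB.instance Definition _ := isMeasure.Build _ _ _ cons_measure
  cons_measure0 cons_measure_ge0 cons_measure_sigma_additive.

Let cons_measure_sigma_finite : sigma_finite setT cons_measure.
Proof.
pose s (t : n.+1.-tuple T) : T * n.-tuple T := (thead t, [tuple of behead t]).
have ms : measurable_fun setT s.
  apply/measurable_fun_pairP; split.
    exact: measurable_tnth.
  exact: measurable_behead.
have consK : cancel (@tuple_cons n) s.
  by case=> x t; rewrite /s /tuple_cons theadE; congr pair; exact/val_inj.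
have /sigma_finiteP[F [TF ndF Foo]] := sigma_finiteT lam.
have /sigma_finiteP[G [TG ndG Goo]] := sigma_finiteT mu.
exists (fun i => s @^-1` (F i `*` G i)).
  apply/esym; rewrite -subTset => t _.
  have [i _ Fi] : (\bigcup_i F i) (s t).1 by rewrite -TF.
  have [j _ Gj] : (\bigcup_i G i) (s t).2 by rewrite -TG.
  exists (maxn i j) => //; split.
    by move: (s t).1 Fi; exact/subsetPset/ndF/leq_maxl.
  by move: (s t).2 Gj; exact/subsetPset/ndG/leq_maxr.
move=> i; have [mF Fi] := Foo i; have [mG Gi] := Goo i; split.
  by rewrite -[_ @^-1` _]setTI; apply: ms => //; exact: measurableX.
rewrite /cons_measure /pushforward.
have -> : @tuple_cons n @^-1` (s @^-1` (F i `*` G i)) = F i `*` G i.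
  by apply/seteqP; split=> x; rewrite /preimage /mkset consK.
by rewrite product_measure1E// lte_mul_pinfty// ge0_fin_numE.
Qed.

HB.instance Definition _ := Measure_isSigmaFinite.Build _ _ _ cons_measure
  cons_measure_sigma_finite.

End cons_measure.

Fixpoint power_measure n : {sigma_finite_measure set (n.-tuple T) -> \bar R} :=
  if n is n'.+1 then cons_measure (power_measure n')
  else \d_([tuple] : 0.-tuple T).

Lemma power_measure_box n (A : 'I_n -> set T) : (forall i, measurable (A i)) ->
  (power_measure n [set t | forall i, A i (tnth t i)] = \prod_i lam (A i))%E.
Proof.
elim: n A => [|n IH] A mA /=.
  rewrite big_ord0 -[RHS](diracT R ([tuple] : 0.-tuple T)); congr dirac.
  by apply/seteqP; split=> // t _ [].
rewrite /cons_measure /pushforward big_ord_recl -IH//.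
rewrite -product_measure1E//; last first.
  rewrite (_ : mkset _ =
    \bigcap_(i : 'I_n) ((@tnth n T)^~ i @^-1` A (lift ord0 i))).
    apply: fin_bigcap_measurable => // i _.
    by rewrite -[_ @^-1` _]setTI; apply: measurable_tnth.
  by apply/seteqP; split=> t /= h i; [move=> _; exact: h | exact: (h i I)].
congr product_measure1; apply/seteqP; split=> -[x t] /= h.
  split=> [|i]; first by have := h ord0.
  by have := h (lift ord0 i); rewrite tnthS.
move=> i; case: (unliftP ord0 i) => [j|] ->; last exact: h.1.
by rewrite tnthS; exact: h.2.
Qed.

End power_measure.

Section lebesgue_rV.
Variables (R : realType) (p : nat).

Definition borel_rV := g_sigma_algebraType (@open 'rV[R]_p).

Definition rV_of_tuple (t : p.-tuple (measurableTypeR R)) : borel_rV :=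
  \row_i tnth t i.

Lemma measurable_rV_of_tuple : measurable_fun setT rV_of_tuple.
Proof.
apply: measurability => // _ [U oU <-]; rewrite setTI.
pose B (i : 'rV[rat]_p * nat) : set 'rV[R]_p :=
  [set y | ball (map_mx ratr i.1 : 'rV[R]_p) i.2.+1%:R^-1 y /\
           ball (map_mx ratr i.1 : 'rV[R]_p) i.2.+1%:R^-1 `<=` U].
have -> : U = \bigcup_i B i.
  apply/seteqP; split=> [x Ux|x [i _ [Bx]]]; last by apply.
  have /nbhs_ballP[e /= e0 xeU] : nbhs x U by exact: open_nbhs_nbhs.
  have [k] := ltr_add_invr (divr_gt0 e0 (ltr0n R 2)); rewrite add0r => ke.
  have k0 : 0 < (k.+1%:R^-1 : R) by rewrite invr_gt0.
  have /choice[q qE] (j : 'I_p) : exists q : rat, `|ratr q - x ord0 j| < k.+1%:R^-1.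
    have : x ord0 j - k.+1%:R^-1 < x ord0 j + k.+1%:R^-1.
      by rewrite ltrD2l (lt_trans _ k0)// oppr_lt0.
    move=> /rat_in_itvoo[q]; rewrite in_itv/= => /andP[q1 q2]; exists q.
    by rewrite ltr_distl q1 q2.
  have qx : ball (map_mx ratr (\row_j q j) : 'rV[R]_p) k.+1%:R^-1 x.
    by split=> // i j; rewrite !mxE ord1; exact: qE.
  exists (\row_j q j, k) => //; split=> //= y qy; apply: xeU.
  apply: le_ball (ball_triangle (ball_sym qx) qy).
  by rewrite [leRHS]splitr lerD// ltW.
rewrite preimage_bigcup; apply: countable_bigcupT_measurable => [|i].
  exact: countableP.
have [iU|iU] := pselect (ball (map_mx ratr i.1 : 'rV[R]_p) i.2.+1%:R^-1 `<=` U);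
  last by rewrite (_ : _ @^-1` _ = set0)//; apply/seteqP; split=> // x [].
rewrite (_ : _ @^-1` _ = \bigcap_(j : 'I_p)
    ((@tnth p (measurableTypeR R))^~ j @^-1` ball (ratr (i.1 ord0 j) : R) i.2.+1%:R^-1)).
  apply: fin_bigcap_measurable => // j _.
  rewrite -[_ @^-1` _]setTI; apply: measurable_tnth => //.
  by rewrite ball_itv; exact: measurable_itv.
apply/seteqP; split=> [t [[_ h] _] j _|t h].
  by have := h ord0 j; rewrite !mxE.
split=> //; split=> [|j k]; first by rewrite invr_gt0.
by rewrite !mxE ord1; exact: h.
Qed.


HB.instance Definition _ := @isMeasurableFun.Build _ _ _ _
  rV_of_tuple measurable_rV_of_tuple.

Definition lebesgue_rV : set borel_rV -> \bar R :=
  pushforward (power_measure (@lebesgue_measure R) p) rV_of_tuple.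

Let lebesgue_rV0 : lebesgue_rV set0 = 0%E.
Proof. exact: measure0. Qed.

Let lebesgue_rV_ge0 A : (0 <= lebesgue_rV A)%E.
Proof. exact: measure_ge0. Qed.

Let lebesgue_rV_sigma_additive : semi_sigma_additive lebesgue_rV.
Proof. exact: measure_semi_sigma_additive. Qed.

HB.instance Definition _ := isMeasure.Build _ _ _ lebesgue_rV
  lebesgue_rV0 lebesgue_rV_ge0 lebesgue_rV_sigma_additive.

Lemma lebesgue_rV_box (a b : 'I_p -> R) : (forall i, a i <= b i) ->
  (lebesgue_rV [set v : 'rV[R]_p | forall i, v ord0 i \in `[a i, b i]] =
   \prod_i (b i - a i)%:E)%E.
Proof.
move=> ab.
transitivity (\prod_i (@lebesgue_measure R) `[a i, b i]%classic)%E.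
  rewrite -power_measure_box//= /lebesgue_rV /pushforward.
  congr (power_measure _ _ _).
  by apply/seteqP; split=> t /= h i; have := h i; rewrite mxE.
apply: eq_bigr => i _; rewrite lebesgue_measure_itv/= lte_fin.
have := ab i; rewrite le_eqVlt => /predU1P[->|->]; last by rewrite EFinB.
by rewrite ltxx subrr.
Qed.

Lemma compact_measurable_rV (X : set 'rV[R]_p) :
  compact X -> measurable (X : set borel_rV).
Proof.
move=> cX; have /closed_openC oX : closed X by exact: compact_closed.
rewrite -[X in measurable X]setCK; apply: measurableC.
exact: sub_sigma_algebra.
Qed.

(* carried by [X], so that its L^2 space is L^2(X) *)
Definition lebesgue_on (X : set 'rV[R]_p) (cX : compact X) :
    {measure set borel_rV -> \bar R} :=
  mrestr lebesgue_rV (compact_measurable_rV cX).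

End lebesgue_rV.

(* The library has the square-integrable functions as a module and their
   almost-everywhere classes as a bare type; [L2 mu] is the quotient as a normed
   module, with the L^2 inner product. *)

Section L2.
Context d (T : measurableType d) (R : realType).
Variable mu : {measure set T -> \bar R}.

Local Open Scope quotient_scope.
Notation Lfun2 := (LfunType mu (lee1n 2)).
Implicit Types (f g : Lfun2) (a : R).

Definition ae_null : {pred Lfun2} := [pred f : Lfun2 | `[< {ae mu, forall x, f x = 0} >]].

Let ae_nullP f : reflect {ae mu, forall x, f x = 0} (f \in ae_null).
Proof. by apply: (iffP idP) => [/asboolP//|?]; apply/asboolP. Qed.

Let ae_null_zmod : zmod_closed ae_null.
Proof.
split; first by apply/ae_nullP; exact: aeW.
move=> f g /ae_nullP f0 /ae_nullP g0; apply/ae_nullP.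
apply: filterS2 f0 g0 => x f0 g0.
by rewrite -[LHS]/(f x - g x) f0 g0 subrr.
Qed.

HB.instance Definition _ :=
  GRing.isZmodClosed.Build Lfun2 ae_null ae_null_zmod.

Definition L2 : Type := Quotient.quot ae_null.
HB.instance Definition _ := Choice.on L2.
HB.instance Definition _ := GRing.Zmodule.on L2.
HB.instance Definition _ := EqQuotient.on L2.

Definition L2_scale a (u : L2) : L2 := \pi_L2 (a *: repr u).

Let L2_eqP f g : reflect {ae mu, forall x, f x = g x} (\pi_L2 f == \pi_L2 g).
Proof.
rewrite -[_ == _]/(f == g %[mod Quotient.quot ae_null]) -Quotient.idealrBE.
apply: (iffP (ae_nullP _)); apply: filterS => x.
  by rewrite -[_ x]/(f x - g x) => /subr0_eq.
by move=> fg; rewrite -[LHS]/(f x - g x) fg subrr.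
Qed.

Let pi_scale a f : \pi_L2 (a *: f) = L2_scale a (\pi_L2 f).
Proof.
apply/eqP/L2_eqP.
have /L2_eqP : \pi_L2 (repr (\pi_L2 f)) == \pi_L2 f by rewrite reprK.
by apply: filterS => x fx; rewrite -[LHS]/(a * f x) -fx.
Qed.

Let pi_D f g : \pi_L2 (f + g) = \pi_L2 f + \pi_L2 g.
Proof. exact: (Quotient.pi_add ae_null f g). Qed.

Let scaleA a b u : L2_scale a (L2_scale b u) = L2_scale (a * b) u.
Proof. by rewrite -[u]reprK -(pi_scale b) -(pi_scale a) -pi_scale scalerA. Qed.

Let scale1 : left_id 1 L2_scale.
Proof. by move=> u; rewrite -[u]reprK -!pi_scale scale1r. Qed.

Let scaleDr : right_distributive L2_scale +%R.
Proof.
by move=> a u v; rewrite -[u]reprK -[v]reprK -!pi_scale -!pi_D -!pi_scale scalerDr.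
Qed.

Let scaleDl u : {morph L2_scale^~ u : a b / a + b}.
Proof. by move=> a b; rewrite -[u]reprK -!pi_scale -!pi_D scalerDl. Qed.

HB.instance Definition _ :=
  GRing.Zmodule_isLmodule.Build R L2 scaleA scale1 scaleDr scaleDl.

Definition L2_norm (u : L2) : R := fine ('N[mu]_2[EFin \o (repr u : Lfun2)])%E.

Let Lnorm_null f : {ae mu, forall x, f x = 0} -> fine ('N[mu]_2[EFin \o f])%E = 0.
Proof.
move=> f0; rewrite unlock (ae_eq_integral (cst 0%E)) ?integral_cst//=.
- by rewrite mul0e poweR0r// invr_neq0.
- apply/measurable_EFinP; apply: (measurableT_comp (measurable_powR 2)).
  by apply: measurableT_comp => //; exact: measurable_funPT.
- by apply: filterS f0 => x /= -> _; rewrite normr0 powR0.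
Qed.

Let L2_norm_pi f : L2_norm (\pi_L2 f) = fine ('N[mu]_2[EFin \o f])%E.
Proof.
set g : Lfun2 := repr (\pi_L2 f).
have fg : {ae mu, forall x, f x = g x}.
  by apply/L2_eqP; rewrite reprK.
have null (h k : Lfun2) : {ae mu, forall x, h x = k x} ->
    fine ('N[mu]_2[EFin \o h])%E <= fine ('N[mu]_2[EFin \o k])%E.
  move=> hk; rewrite -[in leLHS](subrK k h) (le_trans (ler_LnormD _ _))//.
  rewrite gerDr Lnorm_null//; apply: filterS hk => x hk.
  by rewrite -[LHS]/(h x - k x) hk subrr.
apply/eqP; rewrite eq_le !null//.
by apply: filterS fg => x ->.
Qed.

Let L2_normD u v : L2_norm (u + v) <= L2_norm u + L2_norm v.
Proof.
by rewrite -[u]reprK -[v]reprK -pi_D !L2_norm_pi ler_LnormD.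
Qed.

Let L2_normZ a u : L2_norm (a *: u) = `|a| * L2_norm u.
Proof.
rewrite -[u]reprK -[a *: _]pi_scale !L2_norm_pi.
apply: EFin_inj; rewrite EFinM !finite_norm_fine; exact: LnormZ.
Qed.

Let L2_norm_eq0 u : L2_norm u = 0 -> u = 0.
Proof.
move=> /fine_Lnormr_eq0 u0; rewrite -[u]reprK -[RHS]reprK; apply/eqP/L2_eqP.
have pi0 : \pi_L2 0 = 0 by apply: (addrI (\pi_L2 0)); rewrite -pi_D !addr0.
have /L2_eqP : \pi_L2 (repr (0 : L2)) == \pi_L2 0 by rewrite reprK pi0.
by apply: filterS2 u0 => x /(_ I) -> ->.
Qed.

HB.instance Definition _ :=
  Lmodule_isNormed.Build R L2 L2_normD L2_normZ L2_norm_eq0.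

Definition inner (u v : L2) : R :=
  \int[mu]_x ((repr u : Lfun2) x * (repr v : Lfun2) x).

Lemma inner_pi f g : inner (\pi_L2 f) (\pi_L2 g) = \int[mu]_x (f x * g x).
Proof.
have /L2_eqP f0 : \pi_L2 (repr (\pi_L2 f)) == \pi_L2 f by rewrite reprK.
have /L2_eqP g0 : \pi_L2 (repr (\pi_L2 g)) == \pi_L2 g by rewrite reprK.
congr fine; apply: ae_eq_integral => //.
- by apply/measurable_EFinP; apply: measurable_funM; exact: measurable_funPT.
- by apply/measurable_EFinP; apply: measurable_funM; exact: measurable_funPT.
- by apply: filterS2 f0 g0 => x /= -> ->.
Qed.

Lemma sqr_L2_norm (u : L2) : `|u| ^+ 2 = inner u u.
Proof.
have N0 : (0 <= 'N[mu]_2[EFin \o (repr u : Lfun2)])%E by exact: Lnorm_ge0.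
rewrite -[`|u|]/(L2_norm u) -powR_mulrn ?fine_ge0// /inner /Rintegral.
rewrite -[LHS]/(fine (L2_norm u `^ 2)%:E) -poweR_EFin finite_norm_fine.
rewrite powR_Lnorm//; congr fine; apply: eq_integral => x _ /=.
by rewrite powR_mulrn// -normrX ger0_norm ?sqr_ge0// expr2.
Qed.

End L2.

(* A partially defined, possibly nonlinear operator [dom -> U]; the values of
   [op] outside [dom] are irrelevant. *)
Record operator (U : Type) := Operator { dom : set U ; op :> U -> U }.

Definition id_op (U : Type) : operator U := Operator setT id.

Section semiflow.
Variables (R : realType) (U : normedModType R).
Implicit Types (W : operator U) (phi : R -> U -> U).

(* defined where all the terms are *)
Definition lincomb n (c : 'cV[R]_n) (V : 'I_n -> operator U) : operator U :=
  Operator (\bigcap_i dom (V i)) (fun u => \sum_i c i ord0 *: V i u).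

Definition op_span n (V : 'I_n -> operator U) : set (operator U) :=
  [set lincomb c V | c in setT].

(* Convergence in [op_span V] is that of the coefficients; the coefficients are
   unique as soon as the [V i] are linearly independent on a common domain. *)
Definition cvg_in_span n (V : 'I_n -> operator U)
    (F : set_system R) (Wt : R -> operator U) (W0 : operator U) : Prop :=
  exists (c : R -> 'cV[R]_n) (c0 : 'cV[R]_n),
    [/\ (\forall t \near F, Wt t = lincomb (c t) V), c t @[t --> F] --> c0
      & W0 = lincomb c0 V].

(* [phi t] is only meaningful for [0 <= t] *)
Definition is_semiflow phi : Prop :=
  [/\ forall u, phi 0 u = u,
      forall s t u, 0 <= s -> 0 <= t -> phi (s + t) u = phi s (phi t u),
      forall t, 0 <= t -> continuous (phi t)
    & forall u, {within [set t | 0 <= t], continuous (phi^~ u)}].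

(* [x' t = W (x t)] for all [0 <= t]; the derivative is one-sided at [t = 0] *)
Definition classical_solution W (u0 : U) (x : R -> U) : Prop :=
  x 0 = u0 /\
  forall t, 0 <= t -> dom W (x t) /\
    (s - t)^-1 *: (x s - x t) @[s --> within [set s | 0 <= s] t^'] --> W (x t).

Definition generates W phi : Prop :=
  forall u0, dom W u0 -> classical_solution W u0 (phi^~ u0).

Definition invariant_under phi (D : set U) : Prop :=
  forall t u, 0 <= t -> D u -> D (phi t u).

End semiflow.

(* A functional on [D] is represented by a total function on [U], of which only
   the values on [D] matter. *)

Section koopman.
Local Open Scope complex_scope.
Variables (R : realType) (U : normedModType R) (D : set U) (phi : R -> U -> U).
(* the regular module [^o] carries the topology of the complex numbers *)
Notation C := (R[i]^o).
Implicit Types zeta : U -> C.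

(* membership in the space C(D) of bounded continuous functionals *)
Definition Cb zeta : Prop :=
  {within D, continuous zeta} /\ exists M : R, forall u, D u -> `|zeta u| <= M%:C.

Definition koopman (t : R) zeta : U -> C := zeta \o phi t.

Definition lie_quotient zeta (u : U) (t : R) : C :=
  (koopman t zeta u - zeta u) / t%:C.

Definition lie_generator zeta (u : U) : C :=
  lim (lie_quotient zeta u t @[t --> 0^'+]).

Definition lie_domain : set (U -> C) :=
  [set zeta | [/\ Cb zeta,
    forall u, D u -> cvg (lie_quotient zeta u t @[t --> 0^'+])
    & Cb (lie_generator zeta)]].

Definition functional_span n (zeta : 'I_n -> U -> C) : set (U -> C) :=
  [set (fun u => \sum_i c i * zeta i u) | c in [set: 'I_n -> C]].

End koopman.

Section matrix_functions.
Variable R : realType.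

Definition penrose m n (A : 'M[R]_(m, n)) (B : 'M[R]_(n, m)) : Prop :=
  [/\ A *m B *m A = A, B *m A *m B = B,
      (A *m B)^T = A *m B & (B *m A)^T = B *m A].

(* The Moore-Penrose pseudoinverse is the unique solution of the Penrose
   equations. *)
Definition pinvmp m n (A : 'M[R]_(m, n)) : 'M[R]_(n, m) :=
  xget 0 [set B | penrose A B].

Definition expmx n (A : 'M[R]_n) : 'M[R]_n :=
  limn (series (fun k => k`!%:R^-1 *: A ^+ k)).

(* The principal logarithm of a matrix with no eigenvalue in ]-oo, 0] is its
   unique logarithm with spectrum in the strip -pi < Im z < pi; that of a real
   matrix is real, hence the restriction to real [X]. *)
Definition is_principal_log n (A X : 'M[R]_n) : Prop :=
  expmx X = A /\
  forall z : R[i], eigenvalue (map_mx (real_complex R) X) z ->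
    - pi < complex.Im z < pi.

Definition logmx n (A : 'M[R]_n) : 'M[R]_n :=
  xget 0 [set X | is_principal_log A X].

End matrix_functions.

Definition argmin (R : realType) (T : Type) (S : set T) (J : T -> R) : set T :=
  [set x | S x /\ forall y, S y -> J x <= J y].

(* Main.v *)
Require Import Defs.
From HB Require Import structures.
From mathcomp Require Import all_boot all_order all_algebra.
From mathcomp Require Import generic_quotient ring_quotient.
From mathcomp Require Import all_classical all_reals all_analysis.
From mathcomp Require Import complex.
From mathcomp Require Import ring lra.

(** Write [Th] for [Theta1]; it is injective, so [pinvmp Th *m Th = 1] and
    [A ts] is [1 + E ts] with [E ts = pinvmp Th *m (Theta2 ts - Th)]. The basis
    functionals lie in the domain of the Lie generator, hence [E ts / ts] tends
    to [pinvmp Th *m D], where [D] holds the Lie derivatives of the basis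
    functionals at the data points. The logarithm satisfies
    [logmx (1 + E) = E + O(E^2)], so [Lt ts] has the same limit. The first basis
    functional is [u |-> <u, w>], so along a classical solution its Lie
    derivative at [u k] is [y k = <W (u k), w>]. The coefficients of [What ts]
    therefore tend to [pinvmp Th *m y], the unique solution of the least squares
    problem [min |Th *m x - y|^2], and this sum of squares is the cost [J] of
    the operator with coefficients [x].

    The estimate on [logmx] needs some care, because [logmx] is a choice among
    the matrices meeting the definition of a principal logarithm.
    - Existence ([exists_near_log]): for a small [E], a contraction gives a
      matrix [X = E + O(E^2)] with [expmx X = 1 + E] that commutes with all that
      commutes with [E]; its eigenvalues are small, so it is principal.
    - Uniqueness ([principal_log_unique]): another principal logarithm commutes
      with its exponential [1 + E], hence with [X]. Commuting principal
      logarithms of the same matrix agree, because on a common eigenvector the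
      exponential determines the eigenvalue in the strip [|Im z| < pi]
      ([eigenvalue_expmx_inj]).
    The additivity of [expmx] on commuting matrices ([expmxD]) and the value of
    [expmx] on the 2 x 2 matrices of complex multiplications ([expmx_rotmx])
    reduce these facts to the real exponential, sine and cosine. *)

Set Implicit Arguments.
Unset Strict Implicit.
Unset Printing Implicit Defensive.

Import Order.TTheory GRing.Theory Num.Theory.
Import numFieldNormedType.Exports.

Local Open Scope classical_set_scope.
Local Open Scope ring_scope.

(** * Limits of matrices and a submultiplicative norm *)

Section matrix_limits.
Variables (R : realType) (m n : nat).

(** Real matrices form a complete normed module. *)
HB.instance Definition _ := Complete.on 'M[R]_(m, n).

Lemma le_mx_norm (A : 'M[R]_(m, n)) i j : `|A i j| <= `|A|.
Proof.
rewrite [leRHS]/Num.norm /= mx_normrE.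
by apply/bigmax_geP; right => /=; exists (i, j).
Qed.

Lemma mx_norm_le (A : 'M[R]_(m, n)) (c : R) :
  0 <= c -> (forall i j, `|A i j| <= c) -> `|A| <= c.
Proof.
by move=> c0 Ac; rewrite [leLHS]/Num.norm /= mx_normrE; apply: bigmax_le.
Qed.

Lemma cvg_mxP T {F : set_system T} {FF : Filter F} (f : T -> 'M[R]_(m, n))
    (M : 'M[R]_(m, n)) :
  f x @[x --> F] --> M <-> forall i j, f x i j @[x --> F] --> M i j.
Proof.
split=> [fM i j|fM].
  exact: (cvg_comp _ _ fM (@coord_continuous _ _ _ i j M)).
apply/cvgrPdist_le => e e0.
have H : \forall x \near F,
    forall p : 'I_m * 'I_n, `|M p.1 p.2 - f x p.1 p.2| <= e.
  by apply: filter_forall => -[i j]; move/cvgrPdist_le: (fM i j) => /(_ e e0).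
apply: filterS H => x fx; apply: mx_norm_le; first exact: ltW.
by move=> i j; rewrite !mxE; exact: (fx (i, j)).
Qed.

End matrix_limits.

Section mulmx_limits.
Variable R : realType.

Lemma cvg_mulmx m n p T {F : set_system T} {FF : Filter F}
    (f : T -> 'M[R]_(m, n)) (g : T -> 'M[R]_(n, p))
    (A : 'M[R]_(m, n)) (B : 'M[R]_(n, p)) :
  f x @[x --> F] --> A -> g x @[x --> F] --> B ->
  (f x *m g x) @[x --> F] --> A *m B.
Proof.
move=> /cvg_mxP fA /cvg_mxP gB; apply/cvg_mxP => i j; rewrite mxE.
under eq_fun do rewrite mxE.
apply: cvg_big => [|k _]; first exact: add_continuous.
by apply: cvgM; [exact: fA|exact: gB].
Qed.

(** The norm of a matrix is its largest entry in absolute value; scaled by the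
    dimension it becomes submultiplicative. *)
Definition algnorm n (A : 'M[R]_n) : R := n%:R * `|A|.
Local Notation N := algnorm.

Variable n : nat.
Implicit Types A B X Y : 'M[R]_n.

Lemma algnorm_ge0 A : 0 <= N A.
Proof. by rewrite mulr_ge0. Qed.

Lemma algnorm0 : N (0 : 'M[R]_n) = 0.
Proof. by rewrite /algnorm normr0 mulr0. Qed.

Lemma algnormD A B : N (A + B) <= N A + N B.
Proof. by rewrite /algnorm -mulrDr ler_wpM2l// ler_normD. Qed.

Lemma algnormN A : N (- A) = N A.
Proof. by rewrite /algnorm normrN. Qed.

Lemma algnormZ (a : R) A : N (a *: A) = `|a| * N A.
Proof. by rewrite /algnorm normrZ mulrCA. Qed.

Lemma mx_normM m p (A : 'M[R]_(m, n)) (B : 'M[R]_(n, p)) :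
  `|A *m B| <= n%:R * `|A| * `|B|.
Proof.
apply: mx_norm_le => [|i j]; first by rewrite !mulr_ge0.
rewrite mxE (le_trans (ler_norm_sum _ _ _))//.
rewrite (@le_trans _ _ (\sum_(k < n) `|A| * `|B|))//.
  by apply: ler_sum => k _; rewrite normrM ler_pM// le_mx_norm.
by rewrite sumr_const card_ord -[leLHS]mulr_natl mulrA.
Qed.

Lemma algnormM A B : N (A * B) <= N A * N B.
Proof.
by rewrite /algnorm [leRHS]mulrCA ler_wpM2l// mx_normM.
Qed.

Lemma norm_le_algnorm A : `|A| <= N A.
Proof.
case: n A => [|k] A.
  by rewrite (flatmx0 A) normr0 mulr_ge0.
by rewrite /algnorm ler_peMl// ler1n.
Qed.

Lemma mx_norm1 : `|1 : 'M[R]_n| <= 1.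
Proof.
apply: mx_norm_le => // i j; rewrite -[1]/(1%:M) mxE.
by case: eqP; rewrite ?normr1 ?normr0.
Qed.

Lemma normX A k : `|A ^+ k| <= N A ^+ k.
Proof.
elim: k => [|k IH]; first by rewrite !expr0 mx_norm1.
rewrite exprS (le_trans (mx_normM _ _))// exprS.
by rewrite ler_wpM2l// mulr_ge0.
Qed.

End mulmx_limits.

(** * The matrix exponential *)

(** Summation over a triangle of indices, by diagonals and by rows *)
Lemma sum_triangle (V : nmodType) (F : nat -> nat -> V) K :
  \sum_(0 <= k < K) \sum_(i < k.+1) F i (k - i)%N =
  \sum_(0 <= i < K) \sum_(0 <= j < K - i) F i j.
Proof.
elim: K => [|K IH]; first by rewrite !big_nil.
rewrite big_nat_recr//= {}IH [RHS]big_nat_recr//= subSn// subnn big_nat1.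
rewrite big_ord_recr/= subnn addrA; congr (_ + _).
rewrite -(big_mkord xpredT (fun i => F i (K - i)%N)) -big_split/=.
apply: eq_big_nat => i /andP[_ iK].
by rewrite subSn 1?ltnW// big_nat_recr.
Qed.

Lemma sum_square_triangle (V : zmodType) (F : nat -> nat -> V) K :
  \sum_(0 <= i < K) \sum_(0 <= j < K) F i j
    - \sum_(0 <= k < K) \sum_(i < k.+1) F i (k - i)%N =
  \sum_(0 <= i < K) \sum_(K - i <= j < K) F i j.
Proof.
rewrite sum_triangle -sumrB; apply: eq_big_nat => i /andP[_ iK].
rewrite (@big_cat_nat _ _ _ (K - i)%N)//=; last exact: leq_subr.
by rewrite addrAC subrr add0r.
Qed.

Section expmx.
Variable R : realType.
Local Notation N := algnorm.

(** The general term of the exponential series *)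
Definition expmx_coeff n (A : 'M[R]_n) k : 'M[R]_n := k`!%:R^-1 *: A ^+ k.

Lemma norm_expmx_coeff n (A : 'M[R]_n) k :
  `|expmx_coeff A k| <= exp_coeff (N A) k.
Proof.
rewrite /expmx_coeff normrZ /exp_coeff /= mulrC ger0_norm ?invr_ge0//.
by rewrite ler_wpM2r ?invr_ge0// normX.
Qed.

Lemma cvg_expmx n (A : 'M[R]_n) :
  series (expmx_coeff A) x @[x --> \oo] --> expmx A.
Proof.
have : cvgn (series (expmx_coeff A)).
  apply: normed_cvg; apply: series_le_cvg (is_cvg_series_exp_coeff (N A)).
  - by move=> k; exact: normr_ge0.
  - by move=> k; rewrite exp_coeff_ge0// algnorm_ge0.
  - by move=> k; exact: norm_expmx_coeff.
by [].
Qed.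
Arguments cvg_expmx [n] A [t] _.

(** An intertwining relation between matrices passes to their exponentials. With
    [Y = X] this says that what commutes with [X] commutes with [expmx X]. *)
Lemma expmx_intertwine n p (M : 'M[R]_(p, n)) (X : 'M[R]_n) (Y : 'M[R]_p) :
  M *m X = Y *m M -> M *m expmx X = expmx Y *m M.
Proof.
move=> MX.
have XM k : M *m X ^+ k = Y ^+ k *m M.
  elim: k => [|k IH]; first by rewrite !expr0 mulmx1 mul1mx.
  by rewrite exprS -mulmxE mulmxA MX -mulmxA IH mulmxA exprS.
have h1 : M *m series (expmx_coeff X) k @[k --> \oo] --> M *m expmx X.
  by apply: cvg_mulmx; [exact: cvg_cst|exact: cvg_expmx].
have h2 : series (expmx_coeff Y) k *m M @[k --> \oo] --> expmx Y *m M.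
  by apply: cvg_mulmx; [exact: cvg_expmx|exact: cvg_cst].
have E : (fun k => M *m series (expmx_coeff X) k) =
         (fun k => series (expmx_coeff Y) k *m M).
  apply/funext => k; rewrite /series /= mulmx_sumr mulmx_suml.
  by apply: eq_bigr => i _; rewrite /expmx_coeff -scalemxAr XM scalemxAl.
rewrite E in h1; exact: (cvg_unique (@norm_hausdorff _ _) h1 h2).
Qed.

Lemma expmx_coeffD n (X Y : 'M[R]_n) k : X * Y = Y * X ->
  expmx_coeff (X + Y) k =
  \sum_(i < k.+1) expmx_coeff X i * expmx_coeff Y (k - i)%N.
Proof.
move=> XY; rewrite /expmx_coeff addrC exprDn_comm; last exact: esym.
rewrite scaler_sumr; apply: eq_bigr => -[i /= ik] _.
rewrite -mulmxE -scalemxAl -scalemxAr scalerA mulmxE.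
rewrite (commrX i (commr_sym (commrX (k - i) XY)))
  -[X in _ *: X = _]scaler_nat scalerA; congr (_ *: _).
rewrite -(bin_fact (ik : (i <= k)%N)) !natrM.
by field; rewrite !pnatr_eq0 -!lt0n bin_gt0 !fact_gt0.
Qed.

Lemma exp_coeffD (x y : R) k :
  exp_coeff (x + y) k = \sum_(i < k.+1) exp_coeff x i * exp_coeff y (k - i)%N.
Proof.
rewrite /exp_coeff /= addrC exprDn mulr_suml; apply: eq_bigr => -[i /= ik] _.
rewrite -(bin_fact (ik : (i <= k)%N)) -mulr_natr !natrM.
by field; rewrite !pnatr_eq0 -!lt0n bin_gt0 !fact_gt0.
Qed.

(** The difference between the product of the partial sums and the partial sum
    at [X + Y] collects the terms of indices [i, j < K] with [K <= i + j]; it is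
    dominated by the same difference for the real exponential, which tends to 0
    because [expR] is a morphism. *)
Lemma norm_expmx_remainder n (X Y : 'M[R]_n) K : X * Y = Y * X ->
  `|series (expmx_coeff X) K * series (expmx_coeff Y) K
    - series (expmx_coeff (X + Y)) K|
  <= n%:R * (series (exp_coeff (N X)) K * series (exp_coeff (N Y)) K
             - series (exp_coeff (N X + N Y)) K).
Proof.
move=> XY; rewrite /series /=.
under [X in _ - X]eq_bigr do rewrite expmx_coeffD//.
under [X in _ <= _ * (_ - X)]eq_bigr do rewrite exp_coeffD.
rewrite big_distrlr [X in _ <= _ * (X - _)]big_distrlr /= !sum_square_triangle.
rewrite mulr_sumr (le_trans (ler_norm_sum _ _ _))// ler_sum// => i _.
rewrite mulr_sumr (le_trans (ler_norm_sum _ _ _))// ler_sum// => j _.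
rewrite (le_trans (mx_normM _ _))// -mulrA ler_wpM2l//.
by rewrite ler_pM// norm_expmx_coeff.
Qed.

Lemma expmxD n (X Y : 'M[R]_n) : X * Y = Y * X ->
  expmx (X + Y) = expmx X * expmx Y.
Proof.
move=> XY; apply/eqP; rewrite eq_sym -subr_eq0; apply/eqP.
pose r K := series (expmx_coeff X) K * series (expmx_coeff Y) K
    - series (expmx_coeff (X + Y)) K.
have cr : r K @[K --> \oo] --> expmx X * expmx Y - expmx (X + Y).
  apply: cvgB; last exact: cvg_expmx.
  by apply: cvg_mulmx; exact: cvg_expmx.
apply: (cvg_unique (@norm_hausdorff _ _) cr).
apply/norm_cvg0P; apply: (@squeeze_cvgr _ _ _ _ (fun=> 0)
   (fun K => n%:R * (series (exp_coeff (N X)) K * series (exp_coeff (N Y)) K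
             - series (exp_coeff (N X + N Y)) K))).
- by apply: nearW => K; rewrite normr_ge0 norm_expmx_remainder.
- exact: cvg_cst.
- rewrite -[X in _ --> X](mulr0 n%:R); apply: cvgM; first exact: cvg_cst.
  rewrite -[X in _ --> X](subrr (expR (N X + N Y))) {1}expRD.
  by apply: cvgB; [apply: cvgM|]; exact: is_cvg_series_exp_coeff.
Qed.

Lemma expmx0 n : expmx 0 = 1 :> 'M[R]_n.
Proof.
apply: (cvg_unique (@norm_hausdorff _ _) (cvg_expmx 0)).
apply: cvg_near_cst; near=> k.
have k0 : (0 < k)%N by near: k; exact: nbhs_infty_gt.
rewrite /series /= -(prednK k0) big_nat_recl//= big1 ?addr0.
  by rewrite /expmx_coeff fact0 invr1 scale1r expr0.
by move=> i _; rewrite /expmx_coeff expr0n /= scaler0.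
Unshelve. all: by end_near. Qed.

Lemma expmx_comm n (A X : 'M[R]_n) : A * X = X * A -> A * expmx X = expmx X * A.
Proof. exact: expmx_intertwine. Qed.

End expmx.
Arguments cvg_expmx {R} [n] A [t] _.

(** * Solving [expmx X = 1 + E] for a small [E] *)

Section near_identity.
Variables (R : realType) (n : nat).
Local Notation N := algnorm.
Implicit Types A E P X Y : 'M[R]_n.

Lemma algnormX A k : N (A ^+ k.+1) <= N A ^+ k.+1.
Proof.
elim: k => [|k IH]; first by rewrite !expr1.
rewrite exprS (le_trans (algnormM _ _))// [leRHS]exprS.
by rewrite ler_wpM2l// algnorm_ge0.
Qed.

Lemma algnorm_subX (r : R) X Y k : N X <= r -> N Y <= r ->
  N (X ^+ k.+1 - Y ^+ k.+1) <= k.+1%:R * r ^+ k * N (X - Y).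
Proof.
move=> Xr Yr; have r0 := le_trans (algnorm_ge0 X) Xr.
elim: k => [|k IH]; first by rewrite !expr1 expr0 !mul1r.
have -> : X ^+ k.+2 - Y ^+ k.+2 =
    X * (X ^+ k.+1 - Y ^+ k.+1) + (X - Y) * Y ^+ k.+1.
  by rewrite mulrBr mulrBl -!exprS addrA subrK.
rewrite (le_trans (algnormD _ _))//.
have -> : k.+2%:R * r ^+ k.+1 * N (X - Y) =
    r * (k.+1%:R * r ^+ k * N (X - Y)) + N (X - Y) * r ^+ k.+1.
  by rewrite -[k.+2]addn1 natrD exprS; ring.
apply: lerD; apply: le_trans (algnormM _ _) _.
  by rewrite ler_pM// algnorm_ge0.
rewrite ler_wpM2l ?algnorm_ge0// (le_trans (algnormX _ _))//.
by rewrite lerXn2r// nnegrE algnorm_ge0.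
Qed.

Lemma geometric_le2 (r : R) K : 0 <= r -> r <= 2^-1 ->
  \sum_(0 <= k < K) r ^+ k <= 2.
Proof.
move=> r0 r1; elim: K => [|K IH]; first by rewrite big_nil.
rewrite big_nat_recl//= expr0.
under eq_bigr do rewrite exprS.
rewrite -mulr_sumr.
have : r * \sum_(0 <= i < K) r ^+ i <= 2^-1 * 2.
  by rewrite ler_pM// sumr_ge0// => i _; rewrite exprn_ge0.
by rewrite mulVf ?pnatr_eq0//; lra.
Qed.

(** The sum of the terms of degree at least two of the exponential series *)
Definition expmx_tail X : 'M[R]_n := expmx X - 1 - X.

Lemma cvg_expmx_tail X :
  (\sum_(0 <= k < K) expmx_coeff X k.+2) @[K --> \oo] --> expmx_tail X.
Proof.
have c : series (expmx_coeff X) (K + 2)%N @[K --> \oo] --> expmx X.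
  by rewrite (cvg_shiftn 2 (series (expmx_coeff X))); exact: cvg_expmx.
have -> : (fun K => \sum_(0 <= k < K) expmx_coeff X k.+2) =
    (fun K => series (expmx_coeff X) (K + 2)%N - 1 - X).
  apply/funext => K; rewrite addn2 /series /= !big_nat_recl//=.
  rewrite /expmx_coeff fact0 factS fact0 invr1 !scale1r expr0 expr1.
  by apply/esym/eqP; rewrite !subr_eq addrC (addrC X).
by apply: cvgB; [apply: cvgB => //|]; exact: cvg_cst.
Qed.

(** On the ball of radius [r] the term of degree [k] is Lipschitz with constant
    [k r^(k-1) / k!], which is at most [r^(k-1)]; these sum to at most [2 r]. *)
Lemma expmx_tail_lipschitz (r : R) X Y : N X <= r -> N Y <= r -> r <= 2^-1 ->
  N (expmx_tail X - expmx_tail Y) <= 2 * r * N (X - Y).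
Proof.
move=> Xr Yr r1; have r0 := le_trans (algnorm_ge0 X) Xr.
pose d K := \sum_(0 <= k < K) expmx_coeff X k.+2
          - \sum_(0 <= k < K) expmx_coeff Y k.+2.
have cd : d K @[K --> \oo] --> expmx_tail X - expmx_tail Y.
  by apply: cvgB; exact: cvg_expmx_tail.
have cN : N (d K) @[K --> \oo] --> N (expmx_tail X - expmx_tail Y).
  by apply: cvgM; [exact: cvg_cst|exact: cvg_norm].
apply: (cvgr_to_le cN); apply: nearW => K; rewrite /d -sumrB.
rewrite (@le_trans _ _ (\sum_(0 <= k < K) r * N (X - Y) * r ^+ k))//.
  elim: K => [|K IH]; first by rewrite !big_nil algnorm0.
  rewrite !big_nat_recr//= (le_trans (algnormD _ _))// lerD//.
  rewrite /expmx_coeff -scalerBr algnormZ ger0_norm ?invr_ge0//.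
  rewrite mulrC ler_pdivrMr ?ltr0n ?fact_gt0//.
  rewrite (le_trans (algnorm_subX _ Xr Yr))//.
  have -> : r * N (X - Y) * r ^+ K * K.+2`!%:R =
      K.+1`!%:R * (K.+2%:R * r ^+ K.+1 * N (X - Y)).
    by rewrite [in LHS]factS natrM exprS; ring.
  rewrite ler_peMl ?ler1n ?fact_gt0//.
  by rewrite !mulr_ge0 ?exprn_ge0 ?algnorm_ge0.
rewrite -mulr_sumr -[leRHS]mulrA [leRHS]mulrC ler_wpM2l ?geometric_le2//.
by rewrite mulr_ge0 ?algnorm_ge0.
Qed.

Lemma expmx_tail0 : expmx_tail 0 = 0.
Proof. by rewrite /expmx_tail expmx0 subrr subr0. Qed.

Lemma norm_le_algnormP (c : R) X Y : N X <= c * N Y -> `|X| <= c * `|Y|.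
Proof.
case: n X Y => [|k] X Y; first by rewrite (flatmx0 X) (flatmx0 Y) normr0 mulr0.
by rewrite /algnorm mulrCA ler_pM2l.
Qed.

Lemma continuous_algnorm : continuous (@algnorm R n).
Proof. by move=> X; apply: (cvgM (cvg_cst _) (@norm_continuous _ _ X)). Qed.

Lemma closed_commutant P : closed [set X | P * X = X * P].
Proof.
have -> : [set X | P * X = X * P] =
    (fun X => `|P * X - X * P|) @^-1` [set x | x <= 0].
  apply/seteqP; split => X /=; first by move=> ->; rewrite subrr normr0.
  by rewrite normr_le0 subr_eq0 => /eqP.
apply: preimage_closed; last exact: closed_le.
move=> X _; have idX : x @[x --> nbhs X] --> X by exact: cvg_id.
have cP : (fun x : 'M[R]_n => P *m x - x *m P) x @[x --> nbhs X] -->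
    P *m X - X *m P.
  by apply: cvgB; apply: cvg_mulmx => //; exact: cvg_cst.
exact: (cvg_norm cP).
Qed.

(** [expmx X = 1 + E] is the fixed-point equation [X = E - expmx_tail X]. The
    contraction is run on the ball of radius 1/4 intersected with the closed set
    of the matrices commuting with the commutant of [E], so that the fixed point
    inherits this property. On that ball the Lipschitz constant is 1/2, and
    [1/8 + 1/2 * 1/4 = 1/4] keeps the iterates in it. *)
Lemma exists_near_log E : N E <= 8^-1 ->
  exists X, [/\ expmx X = 1 + E, N X <= 2 * N E, N (X - E) <= 8 * N E ^+ 2
              & forall P, P * E = E * P -> P * X = X * P].
Proof.
move=> E8.
pose U := [set X | N X <= 4^-1] `&`
  \bigcap_(P in [set P | P * E = E * P]) [set X | P * X = X * P].
pose f X := E - expmx_tail X.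
have fU X : U X -> U (f X).
  move=> [/= X4 XP]; split => /=.
    have := @expmx_tail_lipschitz 4^-1 X 0 X4.
    rewrite algnorm0 expmx_tail0 !subr0 => /(_ ltac:(lra) ltac:(lra)) tX.
    by rewrite /f (le_trans (algnormD _ _))// algnormN; lra.
  move=> P /= PE; have PX := XP _ PE.
  rewrite /f /expmx_tail !mulrBr !mulrBl PE PX mulr1 mul1r.
  by rewrite (expmx_comm PX).
pose g : {fun U >-> U} := [fun of mkfun fU].
have gc : is_contraction g.
  exists (2^-1)%:nng; split => /=; first lra.
  move=> [X Y] [[/= X4 _] [Y4 _]] /=.
  apply: norm_le_algnormP.
  have -> : mkfun fU X - mkfun fU Y = - (expmx_tail X - expmx_tail Y).
    rewrite -[LHS]/((E - expmx_tail X) - (E - expmx_tail Y)).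
    move: (expmx_tail X) (expmx_tail Y) => a b.
    by rewrite [in RHS]opprB opprD addrACA subrr add0r opprK addrC.
  rewrite algnormN (le_trans (expmx_tail_lipschitz X4 Y4 _))//; first lra.
  by rewrite ler_wpM2r ?algnorm_ge0//; lra.
have Ucl : closed U.
  apply: closedI; last by apply: closed_bigI => P _; exact: closed_commutant.
  apply: (@preimage_closed _ _ (@algnorm R n) [set x | x <= 4^-1]).
    by move=> X _; exact: continuous_algnorm.
  exact: closed_le.
have U0 : U !=set0.
  exists 0; split => /=; first by rewrite algnorm0; lra.
  by move=> P _ /=; rewrite mulr0 mul0r.
have [X [/= X4 XP] Xf] := banach_fixed_point gc Ucl U0.
have {}Xf : X = E - expmx_tail X by [].
have tX : N (expmx_tail X) <= 2 * N X * N X.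
  have := @expmx_tail_lipschitz (N X) X 0 (lexx _).
  rewrite algnorm0 expmx_tail0 !subr0; apply; first exact: algnorm_ge0.
  lra.
have X2 : N X <= 2 * N E.
  have : N X <= N E + N (expmx_tail X).
    by rewrite {1}Xf (le_trans (algnormD _ _))// algnormN.
  have : N X * N X <= 4^-1 * N X by rewrite ler_wpM2r// algnorm_ge0.
  by move: tX; rewrite -mulrA; lra.
exists X; split => //.
- have : X + expmx_tail X = E by rewrite {1}Xf subrK.
  by rewrite /expmx_tail addrC subrK => <-; rewrite addrC subrK.
- rewrite {1}Xf addrAC subrr add0r algnormN (le_trans tX)//.
  have : N X * N X <= (2 * N E) * (2 * N E) by rewrite ler_pM// algnorm_ge0.
  by rewrite expr2 -mulrA; lra.
Qed.

End near_identity.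

(** * Complex eigenvalues of real matrices and the exponential *)

Section rotations.
Variable R : realType.
Implicit Types a b c d : R.

(** The real matrix of the multiplication by [a + i b], acting on the left of
    the matrices of rows [Re v] and [Im v]: with it, complex exponentials are
    exponentials of real matrices. *)
Definition rotmx a b : 'M[R]_2 :=
  \matrix_(i, j) (if i == j then a else if i == ord0 then - b else b).

Lemma rotmxD a b c d : rotmx a b + rotmx c d = rotmx (a + c) (b + d).
Proof.
apply/matrixP => i j; rewrite !mxE; case: ifP => // _.
by case: ifP => // _; rewrite opprD.
Qed.

Lemma rotmxZ k a b : k *: rotmx a b = rotmx (k * a) (k * b).
Proof.
apply/matrixP => i j; rewrite !mxE; case: ifP => // _.
by case: ifP => // _; rewrite mulrN.
Qed.

Lemma rotmx1 : rotmx 1 0 = 1.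
Proof.
rewrite -[RHS]/(1%:M); apply/matrixP => i j; rewrite !mxE oppr0.
by case: eqP => //; case: ifP.
Qed.

Lemma rotmxM a b c d :
  rotmx a b * rotmx c d = rotmx (a * c - b * d) (a * d + b * c).
Proof.
apply/matrixP => i j; rewrite -mulmxE !mxE !big_ord_recl big_ord0 !mxE.
by case: i => -[|[|i]] //= ?; case: j => -[|[|j]] //= ?; ring.
Qed.

Lemma cvg_rotmx T (F : set_system T) (FF : Filter F) (f g : T -> R) a b :
  f x @[x --> F] --> a -> g x @[x --> F] --> b ->
  rotmx (f x) (g x) @[x --> F] --> rotmx a b.
Proof.
move=> fa gb; apply/cvg_mxP => i j; rewrite mxE; under eq_fun do rewrite mxE.
by case: ifP => // _; case: ifP => // _; exact: cvgN.
Qed.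

Lemma rotmx_sum K (f g : nat -> R) :
  \sum_(0 <= k < K) rotmx (f k) (g k) =
  rotmx (\sum_(0 <= k < K) f k) (\sum_(0 <= k < K) g k).
Proof.
elim: K => [|K IH]; last by rewrite !big_nat_recr//= IH rotmxD.
by rewrite !big_nil; apply/matrixP => i j; rewrite !mxE oppr0 !if_same.
Qed.

Lemma rotmx_scalarX a k : rotmx a 0 ^+ k = rotmx (a ^+ k) 0.
Proof.
elim: k => [|k IH]; first by rewrite !expr0 rotmx1.
by rewrite exprS IH rotmxM exprS; congr rotmx; ring.
Qed.

Lemma rotmx_imX b k : rotmx 0 b ^+ k =
  rotmx ((~~ odd k)%:R * (-1) ^+ k./2 * b ^+ k)
        ((odd k)%:R * (-1) ^+ k.-1./2 * b ^+ k).
Proof.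
elim: k => [|k IH]; first by rewrite !expr0 /= !mulr1 rotmx1.
rewrite exprS IH rotmxM [b ^+ k.+1]exprS /= uphalf_half negbK.
case: k {IH} => [|k] /=.
  by congr rotmx; rewrite !expr0; ring.
rewrite uphalf_half negbK; case: (odd k) => /=; rewrite ?exprS;
  by congr rotmx; ring.
Qed.

Lemma expmx_rotmx_scalar a : expmx (rotmx a 0) = rotmx (expR a) 0.
Proof.
apply: (cvg_unique (@norm_hausdorff _ _) (cvg_expmx _)).
have -> : series (expmx_coeff (rotmx a 0)) =
    (fun K => rotmx (series (exp_coeff a) K) (series (cst 0) K)).
  apply/funext => K; rewrite /series /= -rotmx_sum; apply: eq_bigr => k _.
  by rewrite /expmx_coeff rotmx_scalarX rotmxZ mulr0 mulrC.
apply: cvg_rotmx; first exact: is_cvg_series_exp_coeff.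
by rewrite /series /=; under eq_fun do rewrite big1//; exact: cvg_cst.
Qed.

Lemma expmx_rotmx_im b : expmx (rotmx 0 b) = rotmx (cos b) (sin b).
Proof.
apply: (cvg_unique (@norm_hausdorff _ _) (cvg_expmx _)).
have -> : series (expmx_coeff (rotmx 0 b)) =
    (fun K => rotmx (series (cos_coeff b) K) (series (sin_coeff b) K)).
  apply/funext => K; rewrite /series /= -rotmx_sum; apply: eq_bigr => k _.
  by rewrite /expmx_coeff rotmx_imX rotmxZ mulrC [X in rotmx _ X]mulrC.
rewrite unlock; apply: cvg_rotmx.
  exact: is_cvg_series_cos_coeff.
rewrite unlock; exact: is_cvg_series_sin_coeff.
Qed.

Lemma expmx_rotmx a b :
  expmx (rotmx a b) = rotmx (expR a * cos b) (expR a * sin b).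
Proof.
have -> : rotmx a b = rotmx a 0 + rotmx 0 b by rewrite rotmxD addr0 add0r.
rewrite expmxD; last by rewrite !rotmxM; congr rotmx; ring.
by rewrite expmx_rotmx_scalar expmx_rotmx_im rotmxM; congr rotmx; ring.
Qed.

(** Uniqueness of the polar form [e^a (cos b + i sin b)] with an argument in
    the open interval from [- pi] to [pi] *)
Lemma polar_inj a b c d : - pi < b < pi -> - pi < d < pi ->
  expR a * cos b = expR c * cos d -> expR a * sin b = expR c * sin d ->
  a = c /\ b = d.
Proof.
move=> /andP[b1 b2] /andP[d1 d2] hc hs.
have sq (x y : R) : (expR x * cos y) ^+ 2 + (expR x * sin y) ^+ 2 = expR x ^+ 2.
  by rewrite !exprMn -mulrDr cos2Dsin2 mulr1.
have ac : a = c.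
  apply: expR_inj; apply/eqP; rewrite -(@eqrXn2 _ 2) ?expR_ge0//.
  by rewrite -(sq a b) -(sq c d) hc hs.
split=> //; move: hc hs; rewrite ac => /(mulfI _) hc /(mulfI _) hs.
have {}hc : cos b = cos d by apply: hc; rewrite gt_eqF// expR_gt0.
have {}hs : sin b = sin d by apply: hs; rewrite gt_eqF// expR_gt0.
(* [cos (b - d) = 1], so the sine of the half angle [t] is 0, and |t| < pi. *)
pose t := (b - d) / 2.
have ct : cos (t *+ 2) = 1.
  have -> : t *+ 2 = b - d by rewrite /t -mulr_natr divfK// pnatr_eq0.
  by rewrite cosB hc hs -!expr2 cos2Dsin2.
have st : sin t = 0.
  apply/eqP; rewrite -sqrf_eq0; apply/eqP.
  by move: ct; rewrite cos_mulr2n cos2sin2 -mulr_natr; lra.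
have [t0|t0|t0] := ltrgtP t 0.
- have : 0 < sin (- t).
    by apply: sin_gt0_pi; apply/andP; move: t0; rewrite /t; split; lra.
  by rewrite sinN st oppr0 ltxx.
- have : 0 < sin t.
    by apply: sin_gt0_pi; apply/andP; move: t0; rewrite /t; split; lra.
  by rewrite st ltxx.
- by apply/eqP; rewrite -subr_eq0; apply/eqP; move: t0; rewrite /t; lra.
Qed.

End rotations.

Section complex_eigenvectors.
Variables (R : realType) (n : nat).
Local Notation C := (R[i]).
Local Notation cx := (map_mx (real_complex R)).
Implicit Types (v : 'rV[C]_n) (A X Y Z : 'M[R]_n).

Lemma Re_sum I (r : seq I) (F : I -> C) :
  complex.Re (\sum_(i <- r) F i) = \sum_(i <- r) complex.Re (F i).
Proof. by apply: (big_morph (@complex.Re R)) => // -[a b] [c d]. Qed.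

Lemma Im_sum I (r : seq I) (F : I -> C) :
  complex.Im (\sum_(i <- r) F i) = \sum_(i <- r) complex.Im (F i).
Proof. by apply: (big_morph (@complex.Im R)) => // -[a b] [c d]. Qed.

(** The real and imaginary parts of a complex row vector *)
Definition reim_mx v : 'M[R]_(2, n) :=
  \matrix_(i, j) (if i == ord0 then complex.Re (v ord0 j)
                  else complex.Im (v ord0 j)).

Lemma reim_mx_eq0 v : reim_mx v = 0 -> v = 0.
Proof.
move=> /matrixP v0; apply/rowP => j; rewrite mxE.
have := v0 ord0 j; have := v0 (lift ord0 ord0) j; rewrite !mxE /=.
by case: (v ord0 j) => a b /= -> ->.
Qed.

Lemma reim_mx_mul v X : reim_mx (v *m cx X) = reim_mx v *m X.
Proof.
apply/matrixP => i j; rewrite !mxE Re_sum Im_sum.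
case: ifP => i0; apply: eq_bigr => k _; rewrite !mxE i0;
  by case: (v ord0 k) => a b /=; ring.
Qed.

Lemma reim_mx_scale (z : C) v :
  reim_mx (z *: v) = rotmx (complex.Re z) (complex.Im z) *m reim_mx v.
Proof.
apply/matrixP => i j; rewrite !mxE !big_ord_recl big_ord0 !mxE.
by case: i => -[|[|i]] //= ?; case: z => a b; case: (v ord0 j) => c d /=; ring.
Qed.

Lemma expmx_eigenvector v X (z : C) : v *m cx X = z *: v ->
  reim_mx v *m expmx X =
  expmx (rotmx (complex.Re z) (complex.Im z)) *m reim_mx v.
Proof.
by move=> vX; apply: expmx_intertwine; rewrite -reim_mx_mul vX reim_mx_scale.
Qed.

(** An eigenvalue in the strip [- pi < Im z < pi] is determined by the action of
    the exponential on an eigenvector. *)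
Lemma eigenvalue_expmx_inj v X Y (z1 z2 : C) : v != 0 ->
  v *m cx X = z1 *: v -> v *m cx Y = z2 *: v -> expmx X = expmx Y ->
  - pi < complex.Im z1 < pi -> - pi < complex.Im z2 < pi -> z1 = z2.
Proof.
move=> v0 vX vY XY s1 s2.
have := expmx_eigenvector vX; rewrite XY (expmx_eigenvector vY) !expmx_rotmx.
set c1 := _ * cos (complex.Im z2); set d1 := _ * sin (complex.Im z2).
set c2 := _ * cos (complex.Im z1); set d2 := _ * sin (complex.Im z1) => E.
have {}E : rotmx (c1 - c2) (d1 - d2) *m reim_mx v = 0.
  have -> : rotmx (c1 - c2) (d1 - d2) = rotmx c1 d1 - rotmx c2 d2.
    by rewrite -[- rotmx _ _]scaleN1r rotmxZ rotmxD !mulN1r.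
  by rewrite mulmxBl E subrr.
(* Multiply [E] by the conjugate of the difference of the exponentials. *)
have : ((c1 - c2) ^+ 2 + (d1 - d2) ^+ 2) *: reim_mx v = 0.
  have -> : (c1 - c2) ^+ 2 + (d1 - d2) ^+ 2 =
     (c1 - c2) * (c1 - c2) - - (d1 - d2) * (d1 - d2) by ring.
  rewrite -mul_scalar_mx.
  suff <- : rotmx (c1 - c2) (- (d1 - d2)) * rotmx (c1 - c2) (d1 - d2) =
     ((c1 - c2) * (c1 - c2) - - (d1 - d2) * (d1 - d2))%:M.
    by rewrite -mulmxE -mulmxA E mulmx0.
  rewrite rotmxM -[RHS]scalemx1 -[X in _ *: X]rotmx1 rotmxZ; congr rotmx; ring.
move/eqP; rewrite scaler_eq0 => /orP[|/eqP/reim_mx_eq0 v00]; last first.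
  by rewrite v00 eqxx in v0.
rewrite paddr_eq0 ?sqr_ge0// !sqrf_eq0 !subr_eq0 => /andP[/eqP c12 /eqP d12].
have [] := polar_inj s2 s1 c12 d12.
by move: (z1) (z2) => [a1 b1] [a2 b2] /= -> ->.
Qed.

End complex_eigenvectors.

(** A nonzero subspace stable under [f] contains an eigenvector of [f]. *)
Lemma stable_eigenvector (F : numClosedFieldType) m n (V : 'M[F]_(m, n))
    (f : 'M[F]_n) : V != 0 -> (V *m f <= V)%MS ->
  exists v : 'rV_n, exists a, [/\ v != 0, (v <= V)%MS & v *m f = a *: v].
Proof.
move=> V0 Vf; pose B := row_base V; pose C := B *m f *m pinvmx B.
have BC : B *m f = C *m B.
  by rewrite mulmxKpV//; rewrite /B (eqmxMr f (eq_row_base V)) eq_row_base.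
have [a /eigenvalueP[u uC u0]] : exists a, eigenvalue C a.
  have /closed_rootP[a ra] : size (char_poly C) != 1%N.
    by rewrite size_char_poly eqSS mxrank_eq0.
  by exists a; rewrite eigenvalue_root_char.
exists (u *m B), a; split.
- by rewrite mulmx_free_eq0 ?row_base_free.
- by rewrite (submx_trans (submxMl _ _))// eq_row_base.
- by rewrite -mulmxA BC mulmxA uC scalemxAl.
Qed.

(** * The principal logarithm near the identity *)

Section principal_log.
Variables (R : realType) (n : nat).
Local Notation N := algnorm.
Local Notation cx := (map_mx (real_complex R)).
Implicit Types A X Y Z E : 'M[R]_n.

Lemma expmx_square_zero p (M : 'M[R]_(p, n)) Z :
  M *m Z *m Z = 0 -> M *m expmx Z = M + M *m Z.
Proof.
move=> MZZ.
have c : M *m series (expmx_coeff Z) (k + 2)%N @[k --> \oo] --> M *m expmx Z.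
  apply: cvg_mulmx; first exact: cvg_cst.
  by rewrite (cvg_shiftn 2 (series (expmx_coeff Z))); exact: cvg_expmx.
apply: (cvg_unique (@norm_hausdorff _ _) c).
apply: cvg_near_cst; apply: nearW => k.
rewrite addn2 /series /= !big_nat_recl//= /expmx_coeff fact0 factS fact0 invr1.
rewrite !scale1r expr0 expr1 !mulmxDr mulmx1 mulmx_sumr big1 ?addr0// => i _.
by rewrite -scalemxAr 2!exprS -!mulmxE !mulmxA MZZ mul0mx scaler0.
Qed.

(** Two commuting principal logarithms [X] and [Y] of the same matrix are equal.
    Their difference [Z] satisfies [expmx Z = 1], hence [x Z Z = 0] implies
    [x Z = 0]. If [Z] were not 0, its image would contain a common eigenvector
    of [X] and [Y]; the two eigenvalues have the same exponential and lie in the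
    strip, so they agree, and [Z] kills this vector of its image. *)
Lemma principal_log_unique A X Y : X * Y = Y * X ->
  is_principal_log A X -> is_principal_log A Y -> X = Y.
Proof.
move=> XY [eX sX] [eY sY]; apply/eqP; rewrite -subr_eq0; apply/negPn/negP => Z0.
set Z := X - Y in Z0.
have eZ : expmx Z = 1.
  rewrite /Z expmxD; last by rewrite mulrN mulNr XY.
  by rewrite eX -eY -expmxD ?subrr ?expmx0// mulrN mulNr.
have XZ : X * Z = Z * X by rewrite mulrBr mulrBl XY.
have YZ : Y * Z = Z * Y by rewrite mulrBr mulrBl XY.
have cZ0 : cx Z != 0 by rewrite map_mx_eq0.
have comm (P Q : 'M[R]_n) : P * Q = Q * P -> comm_mx (cx P) (cx Q).
  by move=> PQ; rewrite /comm_mx -!map_mxM !mulmxE PQ.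
(* [V] is the part of an eigenspace of [X] that lies in the image of [Z]. *)
have [v0 [a [v00 v0Z v0X]]] :=
  stable_eigenvector cZ0 (comm_mx_stable (comm _ _ (esym XZ))).
pose V := (eigenspace (cx X) a :&: cx Z)%MS.
have V0 : V != 0.
  apply: contra_neq v00 => V0; apply/eqP.
  rewrite -submx0 -V0 sub_capmx v0Z andbT.
  exact/eigenspaceP.
have VY : (V *m cx Y <= V)%MS.
  rewrite sub_capmx (submx_trans (submxMr _ (capmxSl _ _)))/=; last first.
    exact: comm_mx_stable_eigenspace (comm _ _ XY).
  rewrite (submx_trans (submxMr _ (capmxSr _ _)))//.
  exact: comm_mx_stable (comm _ _ (esym YZ)).
have [v [b [vn0 vV vY]]] := stable_eigenvector V0 VY.
move: vV; rewrite sub_capmx => /andP[/eigenspaceP vX /submxP[x vx]].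
have ab : a = b.
  apply: (eigenvalue_expmx_inj vn0 vX vY); first by rewrite eX eY.
    by apply: sX; apply/eigenvalueP; exists v.
  by apply: sY; apply/eigenvalueP; exists v.
have vZ : v *m cx Z = 0 by rewrite map_mxB mulmxBr vX vY ab subrr.
have := @expmx_square_zero 2 (reim_mx x) Z.
rewrite (eZ : _ = 1%:M) mulmx1 -!reim_mx_mul -vx vZ => /(_ _)/eqP.
rewrite -subr_eq0 opprD addrA subrr add0r oppr_eq0 => H.
move/eqP: vn0; apply; apply: reim_mx_eq0; apply/eqP; apply: H.
by apply/matrixP => i j; rewrite !mxE if_same.
Qed.

(** The moduli of the eigenvalues of [X], hence their imaginary parts, are at
    most [N X]: look at the equation [v X = z v] at an entry of [v] of maximal
    modulus. *)
Lemma eigenvalue_algnorm X (z : R[i]) :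
  eigenvalue (cx X) z -> `|complex.Im z| <= N X.
Proof.
move=> /eigenvalueP[v vX v0].
have [i0 vi0] : exists i, v ord0 i != 0 by exact/rV0Pn.
have [j _ jmax] := @real_arg_maxP _ _ i0 xpredT (fun i => `|v ord0 i|) isT
  (fun i _ => normr_real _).
have vj0 : 0 < `|v ord0 j| by rewrite (lt_le_trans _ (jmax i0 isT))// normr_gt0.
have nX k l : `|(X k l)%:C%C| <= (`|X|)%:C%C :> R[i].
  by rewrite normc_def /= expr0n addr0 sqrtr_sqr lecR le_mx_norm.
have zN : `|z| <= (N X)%:C%C.
  rewrite -(ler_pM2r vj0) -normrM.
  have -> : z * v ord0 j = \sum_k v ord0 k * (X k j)%:C%C.
    move/rowP/(_ j): vX; rewrite !mxE => <-.
    by apply: eq_bigr => k _; rewrite mxE.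
  rewrite (le_trans (ler_norm_sum _ _ _))//.
  rewrite (@le_trans _ _ (\sum_(k < n) (`|X|)%:C%C * `|v ord0 j|))//.
    apply: ler_sum => k _; rewrite normrM mulrC ler_pM//; exact: jmax.
  by rewrite sumr_const card_ord /algnorm rmorphM rmorph_nat -mulrA mulr_natl.
rewrite -lecR (le_trans _ zN)// normc_def lecR -[leLHS]sqrtr_sqr ler_sqrt.
  by rewrite lerDr sqr_ge0.
by rewrite addr_ge0// sqr_ge0.
Qed.

(** Near the identity the principal logarithm exists, and it is [E + O(E^2)] at
    [1 + E]. *)
Lemma logmx_near_identity E : N E <= 8^-1 ->
  is_principal_log (1 + E) (logmx (1 + E)) /\
  N (logmx (1 + E) - E) <= 8 * N E ^+ 2.
Proof.
move=> E8; have [X [eX X2 XE cX]] := exists_near_log E8.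
have pX : is_principal_log (1 + E) X.
  split=> // z /eigenvalue_algnorm zX; have := @pi_ge2 R.
  have : `|complex.Im z| < 2.
    by rewrite (le_lt_trans zX)// (le_lt_trans X2)//; lra.
  by rewrite ltr_norml => /andP[z1 z2] p2; apply/andP; split; lra.
suff -> : logmx (1 + E) = X by [].
have pL : is_principal_log (1 + E) (logmx (1 + E)).
  by apply: (@xgetPex _ 0 [set X | is_principal_log (1 + E) X]); exists X.
apply: (principal_log_unique _ pL pX).
apply: cX; have : logmx (1 + E) * expmx (logmx (1 + E)) =
  expmx (logmx (1 + E)) * logmx (1 + E) by exact: expmx_comm.
by rewrite pL.1 mulrDr mulrDl mulr1 mul1r => /addrI.
Qed.

End principal_log.

(** * The inner product of L^2 *)

Section inner_product.
Context d (T : measurableType d) (R : realType).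
Variable mu : {measure set T -> \bar R}.
Local Open Scope quotient_scope.
Implicit Types (u v w : L2 mu) (a : R).

Lemma innerC u v : inner u v = inner v u.
Proof. by rewrite /inner; apply: eq_Rintegral => x _; rewrite mulrC. Qed.

Lemma inner_linear a u v w :
  inner (a *: u + v) w = a * inner u w + inner v w.
Proof.
pose f : LfunType mu (lee1n 2) := repr u.
pose g : LfunType mu (lee1n 2) := repr v.
pose h : LfunType mu (lee1n 2) := repr w.
have int2 (k l : LfunType mu (lee1n 2)) :
    mu.-integrable setT (EFin \o (fun x => k x * l x)).
  by apply/Lfun1_integrable/Lfun2_mul_Lfun1; exact: LfunP.
have -> : a *: u + v = \pi_(L2 mu) (a *: f + g).
  rewrite -[in LHS](reprK v) -[a *: u]/(\pi_(L2 mu) (a *: f)).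
  by rewrite (Quotient.pi_add (@ae_null _ _ _ mu) (a *: f) g).
rewrite -[in LHS](reprK w) inner_pi -/h.
rewrite -RintegralZl// -RintegralD//; last first.
  rewrite (_ : _ \o _ = EFin \o (fun x => (a *: f) x * h x))//.
  by apply/funext => x /=; rewrite mulrA.
by apply: eq_Rintegral => x _; rewrite /= mulrDl mulrA.
Qed.

Lemma innerD u v w : inner (u + v) w = inner u w + inner v w.
Proof. by rewrite -[u in LHS]scale1r inner_linear mul1r. Qed.

Lemma inner0 w : inner (0 : L2 mu) w = 0.
Proof. by apply: (addIr (inner 0 w)); rewrite -innerD !add0r. Qed.

Lemma innerZ a u w : inner (a *: u) w = a * inner u w.
Proof. by rewrite -[a *: u]addr0 inner_linear inner0 addr0. Qed.

Lemma innerB u v w : inner (u - v) w = inner u w - inner v w.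
Proof. by rewrite innerD -scaleN1r innerZ mulN1r. Qed.

Lemma inner_sum I (r : seq I) (F : I -> L2 mu) w :
  inner (\sum_(i <- r) F i) w = \sum_(i <- r) inner (F i) w.
Proof.
by apply: (big_morph (fun u => inner u w)) => [u v|]; rewrite ?innerD ?inner0.
Qed.

(** Cauchy-Schwarz inequality *)
Lemma norm_inner_le u w : `|inner u w| <= `|u| * `|w|.
Proof.
have [->|w0] := eqVneq w 0; first by rewrite innerC inner0 !normr0 mulr0.
have w2 : 0 < `|w| ^+ 2 by rewrite exprn_gt0// normr_gt0.
rewrite -(@ler_pXn2r _ 2) ?nnegrE ?mulr_ge0// exprMn real_normK ?num_real//.
rewrite -subr_ge0 -(pmulr_rge0 _ w2).
(* [z] is |w|^2 times the component of [u] orthogonal to [w]. *)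
pose z := (`|w| ^+ 2) *: u - inner u w *: w.
have zE v : inner z v = `|w| ^+ 2 * inner u v - inner u w * inner w v.
  by rewrite innerB !innerZ.
have := sqr_ge0 `|z|.
rewrite (sqr_L2_norm z) zE (innerC u z) (innerC w z) !zE.
rewrite -!sqr_L2_norm (innerC w u).
suff -> : forall a b c : R, a * (a * b - c * c) - c * (a * c - c * a)
  = a * (b * a - c ^+ 2) by [].
by move=> a b c; ring.
Qed.

Lemma cvg_inner S (F : set_system S) (FF : Filter F) (f : S -> L2 mu) u w :
  f x @[x --> F] --> u -> inner (f x) w @[x --> F] --> inner u w.
Proof.
move=> /cvgrPdist_le fu; apply/cvgrPdist_le => e e0.
have w1 : 0 < `|w| + 1 by rewrite ltr_wpDl.
apply: filterS (fu (e / (`|w| + 1)) _); last by rewrite divr_gt0.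
move=> x; rewrite -innerB => fx; rewrite (le_trans (norm_inner_le _ _))//.
rewrite (le_trans (ler_wpM2r (normr_ge0 w) fx))// -mulrA ler_piMr ?(ltW e0)//.
by rewrite mulrC ler_pdivrMr// mul1r lerDl.
Qed.

End inner_product.

(** * The pseudoinverse and least squares *)

Section least_squares.
Variables (R : realType) (m n : nat).

(** The squared Euclidean norm *)
Definition sqnorm k (x : 'cV[R]_k) : R := \sum_i x i ord0 ^+ 2.

Lemma sqnormE k (x : 'cV[R]_k) : x^T *m x = (sqnorm x)%:M.
Proof.
apply/matrixP => i j; rewrite !ord1 !mxE eqxx mulr1n.
by apply: eq_bigr => k' _; rewrite mxE expr2.
Qed.

Lemma sqnorm_ge0 k (x : 'cV[R]_k) : 0 <= sqnorm x.
Proof. by rewrite sumr_ge0// => i _; rewrite sqr_ge0. Qed.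

Lemma sqnorm_eq0 k (x : 'cV[R]_k) : sqnorm x = 0 -> x = 0.
Proof.
move=> /psumr_eq0P x0; apply/colP => i; rewrite mxE; apply/eqP.
by rewrite -sqrf_eq0; apply/eqP/x0 => // j _; rewrite sqr_ge0.
Qed.

Variable Th : 'M[R]_(m, n).
Hypothesis Th_inj : forall x : 'cV[R]_n, Th *m x = 0 -> x = 0.

Lemma gram_unit : Th^T *m Th \in unitmx.
Proof.
rewrite -row_free_unit; apply: inj_row_free => v vG.
apply: trmx_inj; rewrite trmx0; apply: Th_inj; apply: sqnorm_eq0.
have := sqnormE (Th *m v^T).
rewrite trmx_mul trmxK mulmxA -(mulmxA v) vG mul0mx => /matrixP/(_ ord0 ord0).
by rewrite !mxE eqxx mulr1n.
Qed.

Lemma penrose_pinvmp : penrose Th (pinvmp Th).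
Proof.
rewrite /pinvmp; apply: (@xgetPex _ 0 [set B | penrose Th B]).
exists (invmx (Th^T *m Th) *m Th^T).
have BT : invmx (Th^T *m Th) *m Th^T *m Th = 1%:M.
  by rewrite -mulmxA mulVmx// gram_unit.
split.
- by rewrite -mulmxA BT mulmx1.
- by rewrite BT mul1mx.
- by rewrite !trmx_mul trmxK trmx_inv trmx_mul trmxK mulmxA.
- by rewrite BT trmx1.
Qed.

Lemma pinvmpK : pinvmp Th *m Th = 1%:M.
Proof.
have [TBT _ _ _] := penrose_pinvmp.
have G := gram_unit.
have : (Th^T *m Th) *m (pinvmp Th *m Th) = Th^T *m Th.
  by rewrite -!mulmxA (mulmxA Th) TBT.
by move=> /(congr1 (mulmx (invmx (Th^T *m Th)))); rewrite mulKmx// mulVmx.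
Qed.

(** The normal equations satisfied by [pinvmp Th *m y] *)
Lemma pinvmp_normal : Th^T *m Th *m pinvmp Th = Th^T.
Proof.
have [TBT _ TBs _] := penrose_pinvmp.
by rewrite -mulmxA -TBs -trmx_mul TBT.
Qed.

(** Pythagoras for the residual at the least squares solution, which is
    orthogonal to the range of [Th] *)
Lemma least_squares (y : 'cV[R]_m) (x : 'cV[R]_n) :
  sqnorm (Th *m x - y) =
  sqnorm (Th *m (pinvmp Th *m y) - y) + sqnorm (Th *m (x - pinvmp Th *m y)).
Proof.
set r := Th *m (pinvmp Th *m y) - y; set e := x - pinvmp Th *m y.
have er : (Th *m e)^T *m r = 0.
  by rewrite trmx_mul -mulmxA /r mulmxBr !mulmxA pinvmp_normal subrr mulmx0.
have re : r^T *m (Th *m e) = 0 by rewrite -[LHS]trmxK trmx_mul trmxK er trmx0.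
have -> : Th *m x - y = r + Th *m e.
  by rewrite /r /e mulmxBr [RHS]addrC addrA subrK.
move: er re; clearbody r e => er re; have := sqnormE (r + Th *m e).
rewrite [(r + _)^T]linearD /= mulmxDl !mulmxDr er re addr0 add0r.
rewrite !sqnormE -raddfD /=.
by move/matrixP/(_ ord0 ord0); rewrite !mxE eqxx !mulr1n.
Qed.

End least_squares.

(** * Derivatives at [0^'+] *)

Section one_sided_derivatives.
Variable R : realType.
Local Notation N := algnorm.

(** A curve [1 + E t] that leaves the identity with velocity [D] has a logarithm
    that leaves 0 with velocity [D]. *)
Lemma cvg_logmx_quotient n (E : R -> 'M[R]_n) (D : 'M[R]_n) :
  t^-1 *: E t @[t --> 0^'+] --> D ->
  (\forall t \near 0^'+, is_principal_log (1 + E t) (logmx (1 + E t))) /\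
  t^-1 *: logmx (1 + E t) @[t --> 0^'+] --> D.
Proof.
move=> ED.
have tE : t @[t --> 0^'+] --> (0 : R).
  by apply: cvg_at_right_filter; exact: cvg_id.
have cN : N (t^-1 *: E t) @[t --> 0^'+] --> N D.
  exact: (continuous_cvg _ (@continuous_algnorm _ _ D)).
have scale t : 0 < t -> N (E t) = t * N (t^-1 *: E t).
  by move=> t0; rewrite algnormZ gtr0_norm ?invr_gt0// mulVKf// gt_eqF.
have NE : \forall t \near 0^'+, N (E t) <= 8^-1.
  have /cvgr_le : t * N (t^-1 *: E t) @[t --> 0^'+] --> 0 * N D by exact: cvgM.
  rewrite mul0r => /(_ 8^-1 ltac:(lra)) H.
  near=> t; rewrite scale; last by near: t; exact: nbhs_right_gt.
  by near: t; exact: H.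
split; first by apply: filterS NE => t /logmx_near_identity[].
rewrite -[D]addr0.
have -> : (fun t => t^-1 *: logmx (1 + E t)) =
    (fun t => t^-1 *: E t + t^-1 *: (logmx (1 + E t) - E t)).
  by apply/funext => t; rewrite -scalerDr [E t + _]addrC subrK.
apply: cvgD => //.
apply/norm_cvg0P.
apply: (@squeeze_cvgr _ _ _ _ (fun=> 0)
   (fun t => 8 * (t * (N (t^-1 *: E t) * N (t^-1 *: E t))))); last 2 first.
- exact: cvg_cst.
- have := cvgM (cvg_cst (8 : R)) (cvgM tE (cvgM cN cN)).
  by rewrite mul0r mulr0; apply.
near=> t.
have t0 : 0 < t by near: t; exact: nbhs_right_gt.
rewrite normr_ge0 /= (le_trans (norm_le_algnorm _))//.
rewrite algnormZ gtr0_norm ?invr_gt0// mulrC ler_pdivrMr//.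
have [_ /le_trans] : is_principal_log (1 + E t) (logmx (1 + E t)) /\
    N (logmx (1 + E t) - E t) <= 8 * N (E t) ^+ 2.
  by apply: logmx_near_identity; near: t; exact: NE.
by apply; rewrite (scale _ t0) expr2 le_eqVlt; apply/orP; left; apply/eqP; ring.
Unshelve. all: by end_near. Qed.

(** Existence of the Lie derivative of a real functional seen as a complex one
    gives that of its real derivative along the flow. *)
Lemma cvg_lie_quotient (U : normedModType R) (phi : R -> U -> U)
    (f : U -> R) (u : U) :
  cvg (lie_quotient phi (fun v => (f v)%:C%C : R[i]^o) u t @[t --> 0^'+]) ->
  cvg (t^-1 * (f (phi t u) - f u) @[t --> 0^'+]).
Proof.
move=> /cvg_ex[z /cvgrPdist_le fz]; apply/cvg_ex; exists (complex.Re z).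
apply/cvgrPdist_le => e e0.
have := fz e%:C%C; rewrite ltcR => /(_ e0); apply: filterS => t.
have -> : lie_quotient phi (fun v => (f v)%:C%C) u t =
    (t^-1 * (f (phi t u) - f u))%:C%C.
  by rewrite /lie_quotient /koopman /= mulrC rmorphM rmorphB fmorphV.
move=> /(le_trans (normc_ge_Re _)); rewrite lecR.
by case: (z) => a b /=.
Qed.

Lemma cvg_classical_solution (U : normedModType R) (W : operator U) (u0 : U)
    (x : R -> U) : classical_solution W u0 x ->
  t^-1 *: (x t - u0) @[t --> 0^'+] --> W u0.
Proof.
move=> [x0 /(_ 0 (lexx _))[_]]; rewrite x0.
under eq_fun do rewrite subr0.
apply: cvg_trans => P /= [e e0 eP]; exists e => //= t te t0.
by apply: eP => //; [rewrite gt_eqF|exact: ltW].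
Qed.

End one_sided_derivatives.

(** * Convergence to the least squares fit *)

Local Open Scope complex_scope.

Theorem corollary1 (R : realType) (p : nat) (X : set 'rV[R]_p) (cX : compact X)
    (U := L2 (lebesgue_on cX) : normedModType R)
    (q : nat) (c : 'cV[R]_q) (Wi : 'I_q -> operator U)
    (W := lincomb c Wi : operator U)
    (phi : R -> U -> U) (Ubar : set U) (w : U)
    (n m : nat) (n_gt0 : (0 < n)%N) (n_le_m : (n <= m)%N)
    (i1 := Ordinal n_gt0 : 'I_n)
    (V : 'I_n -> operator U)
    (zeta := (fun i v => inner (V i v) w) : 'I_n -> U -> R)
    (zetaC := (fun i v => (zeta i v)%:C) : 'I_n -> U -> R[i]^o)
    (u : 'I_m -> U)
    (Theta1 := (\matrix_(k, i) zeta i (u k)) : 'M[R]_(m, n))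
    (Theta2 := (fun ts => \matrix_(k, i) zeta i (phi ts (u k))) : R -> 'M[R]_(m, n))
    (A := (fun ts => pinvmp Theta1 *m Theta2 ts) : R -> 'M[R]_n)
    (Lt := (fun ts => ts^-1 *: logmx (A ts)) : R -> 'M[R]_n)
    (What := (fun ts => lincomb (\col_i Lt ts i i1) V) : R -> operator U)
    (J := (fun Wt : operator U =>
             \sum_(k < m) `|inner (Wt (u k) - W (u k)) w| ^+ 2) : operator U -> R) :
  is_semiflow phi ->
  generates W phi ->
  Ubar `<=` dom W ->
  invariant_under phi Ubar ->
  V i1 = id_op U ->
  (forall i, Ubar `<=` dom (V i)) ->
  (forall i, Cb Ubar (zetaC i)) ->
  functional_span zetaC `<=` lie_domain Ubar phi ->
  (forall k, Ubar (u k)) ->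
  free [tuple (\row_k zeta i (u k) : 'rV[R]_m) | i < n] ->
  (\forall ts \near 0^'+, exists X0, is_principal_log (A ts) X0) /\
  exists W0 : operator U,
    cvg_in_span V 0^'+ What W0 /\ argmin (op_span V) J = [set W0].
Proof.
move=> _ genW UW _ V1 _ _ dL Uu freeT.
have Tinj (x : 'cV[R]_n) : Theta1 *m x = 0 -> x = 0.
  move=> Tx; apply/colP => i; rewrite mxE.
  move/freeP: freeT => /(_ (fun i => x i ord0)); apply; apply/rowP => k.
  rewrite summxE [RHS]mxE; transitivity ((Theta1 *m x) k ord0); last first.
    by rewrite Tx mxE.
  rewrite [RHS]mxE; apply: eq_bigr => j _.
  by rewrite (nth_map j) ?size_enum_ord// nth_ord_enum !mxE mulrC.
pose y : 'cV[R]_m := \col_k inner (W (u k)) w.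
pose dq k i (t : R) : R := t^-1 * (zeta i (phi t (u k)) - zeta i (u k)).
have dq_cvg k i : cvg (dq k i t @[t --> 0^'+]).
  apply: cvg_lie_quotient; have [|_ + _] := dL (zetaC i); last exact.
  exists (fun j => (j == i)%:R) => //; apply/funext => v.
  rewrite (bigD1 i)//= eqxx mul1r big1 ?addr0// => j /negPf ->.
  by rewrite mul0r.
(* the Lie derivatives of the basis functionals at the data points *)
pose D : 'M[R]_(m, n) := \matrix_(k, i) lim (dq k i t @[t --> 0^'+]).
have Dy k : D k i1 = y k ord0.
  rewrite !mxE; apply: cvg_lim => //.
  have -> : dq k i1 = fun t => inner (t^-1 *: (phi t (u k) - u k)) w.
    by apply/funext => t; rewrite innerZ innerB /dq /zeta V1.
  by apply: cvg_inner; exact: cvg_classical_solution (genW _ (UW _ (Uu k))).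
pose E t := pinvmp Theta1 *m (Theta2 t - Theta1).
have AE : A = (fun t => 1 + E t).
  by apply/funext => t; rewrite /E mulmxBr (pinvmpK Tinj) addrC subrK.
have ED : t^-1 *: E t @[t --> 0^'+] --> pinvmp Theta1 *m D.
  under eq_fun do rewrite /E scalemxAr.
  apply: cvg_mulmx; first exact: cvg_cst.
  apply/cvg_mxP => k i; under eq_fun do rewrite !mxE.
  by rewrite mxE; exact: dq_cvg.
have [logA LD] := cvg_logmx_quotient ED.
split.
  by rewrite AE; apply: filterS logA => t; exists (logmx (1 + E t)).
pose c0 := pinvmp Theta1 *m y.
exists (lincomb c0 V); split.
  exists (fun t => \col_i Lt t i i1), c0; split => //; first exact: nearW.
  apply/cvg_mxP => i j; rewrite ord1; under eq_fun do rewrite mxE.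
  have -> : c0 i ord0 = (pinvmp Theta1 *m D) i i1.
    by rewrite !mxE; apply: eq_bigr => k _; rewrite Dy.
  by rewrite /Lt AE; move/cvg_mxP: LD; exact.
have JE x : J (lincomb x V) = sqnorm (Theta1 *m x - y).
  apply: eq_bigr => k _; rewrite real_normK ?num_real//; congr (_ ^+ 2).
  rewrite innerB /= inner_sum !mxE; congr (_ - _).
  by apply: eq_bigr => i _; rewrite innerZ mxE mulrC.
apply/seteqP; split => [Wt [[x _ <-]]|_ ->].
  move=> /(_ (lincomb c0 V)) /(_ (ex_intro2 _ _ c0 I erefl)).
  rewrite !JE (least_squares Tinj y x) gerDl => h.
  suff -> : x = c0 by [].
  apply/eqP; rewrite -subr_eq0; apply/eqP/Tinj/sqnorm_eq0/eqP.
  by rewrite eq_le h sqnorm_ge0.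
split; first by exists c0.
move=> _ [x _ <-]; rewrite !JE (least_squares Tinj y x).
by rewrite lerDl sqnorm_ge0.
Qed.
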